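(* Let $K$ be a field and let $I,J\subset S=K[x_1,\ldots,x_n]$ be two monomial ideals, where $G(J)=\{u_1,\ldots,u_k\}$ is the set of minimal monomial generators of $J$. Then: (1) $\operatorname{sdepth}_S(I:J)\ \ge\ \operatorname{sdepth}_S(I:u_1)+\operatorname{sdepth}_S(I:u_2)+\cdots+\operatorname{sdepth}_S(I:u_k)-n(k-1)\ \ge\ k\operatorname{sdepth}_S(I)-n(k-1)$. (2) $\operatorname{sdepth}_S(S/(I:J))\ \ge\ \min_{1\le i\le k}\Big\{\operatorname{sdepth}_S(S/(I:u_i))+\sum_{j=1}^{i-1}\operatorname{sdepth}_S(I:u_j)-n(i-1)\Big\}\ \ge\ \operatorname{sdepth}_S(S/I)+(k-1)\operatorname{sdepth}_S(I)-n(k-1)$.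
   Context: Let $S=K[x_1,\ldots,x_n]$ with its $\mathbb Z^n$-grading, and let $M\neq 0$ be a finitely generated $\mathbb Z^n$-graded $S$-module. A Stanley decomposition of $M$ is a finite direct sum decomposition of $K$-vector spaces $\mathcal D: M=\bigoplus_{i=1}^t m_iK[Z_i]$, where the $m_i\in M$ are homogeneous, $Z_i\subset\{x_1,\ldots,x_n\}$, and each $m_iK[Z_i]$ is a free $K[Z_i]$-module. Put $\operatorname{sdepth}(\mathcal D)=\min_i|Z_i|$, and let $\operatorname{sdepth}_S(M)$ be the maximum of $\operatorname{sdepth}(\mathcal D)$ over all Stanley decompositions of $M$. Stanley depth is considered only for nonzero modules: $I$ and $J$ are nonzero, and (2) is asserted when all modules occurring in it are nonzero (i.e. $u_i\notin I$ for all $i$). Colon ideals: $(I:J)=\{f\in S: fJ\subset I\}$ and $(I:u)=\{f\in S: fu\in I\}$. *)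

(* Defs.v *)
From HB Require Import structures.
From mathcomp Require Import all_boot all_order all_algebra.
From mathcomp Require Import boolp.
From mathcomp Require Import mpoly.

Set Implicit Arguments.
Unset Strict Implicit.
Unset Printing Implicit Defensive.

Import Order.TTheory GRing.Theory Num.Theory.
Local Open Scope ring_scope.
Local Open Scope quotient_scope.

Section MonomialIdeals.
Context {K : fieldType} {n : nat}.
Implicit Types (A G : 'X_{1..n} -> Prop) (f g p : {mpoly K[n]}).

Definition in_mon_span A f : Prop :=
  exists2 s : seq ({mpoly K[n]} * 'X_{1..n}),
    (forall q, q \in s -> A q.2) & f = \sum_(q <- s) q.1 * 'X_[q.2].

Definition generated_by (P : {pred {mpoly K[n]}}) A : Prop :=
  forall f, f \in P <-> in_mon_span A f.

(* The regular module {mpoly K[n]}^o is S seen as a module over itself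
   (mpoly's own lmodType structure is the one over K). *)
Record monomialIdeal := MonomialIdeal {
  mon_mem :> {pred {mpoly K[n]}^o};
  mon_memP : exists A, generated_by mon_mem A
}.

Definition is_min_mon_gens (J : monomialIdeal) G : Prop :=
  generated_by J G /\
  forall G', (forall m, G' m -> G m) -> generated_by J G' ->
             forall m, G m -> G' m.

Definition nonzero_ideal (I : monomialIdeal) : Prop :=
  exists2 f : {mpoly K[n]}, f \in I & f != 0.

Lemma mon_submod_closed (I : monomialIdeal) : submod_closed (mon_mem I).
Proof.
have [A HA] := mon_memP I; split.
  apply: (HA 0).2; exists [::]; first by move=> q; rewrite in_nil.
  by rewrite big_nil.
move=> a f g /HA[s As ->] /HA[t At ->]; apply/HA.
exists ([seq (a * q.1, q.2) | q <- s] ++ t).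
  move=> q; rewrite mem_cat => /orP[/mapP[r rs ->]|]; [exact: (As r) | exact: At].
rewrite big_cat big_map /=; congr (_ + _).
rewrite /GRing.scale /= mulr_sumr; apply: eq_bigr => q _.
by rewrite mulrA.
Qed.

HB.instance Definition _ (I : monomialIdeal) :=
  GRing.isSubmodClosed.Build {mpoly K[n]} {mpoly K[n]}^o (mon_mem I)
    (mon_submod_closed I).

Lemma monMl (I : monomialIdeal) f g : g \in I -> f * g \in I.
Proof.
by move=> gI; have [I0 IZ] := mon_submod_closed I; rewrite -[f * g]addr0 IZ.
Qed.

Lemma mon_msupp (I : monomialIdeal) f m :
  f \in I -> m \in msupp f -> 'X_[m] \in I.
Proof.
have [A HA] := mon_memP I.
move=> /HA[s As ->]; move/msupp_sum_le; case/flattenP=> c.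
case/mapP=> q; rewrite filter_predT => qs -> {c}.
rewrite (perm_mem (msuppMX _ _)) => /mapP[m' _ ->].
rewrite addmC mpolyXD; apply: monMl; apply: (HA 'X_[q.2]).2.
exists [:: (1, q.2)]; last by rewrite big_seq1 mul1r.
by move=> r; rewrite inE => /eqP->; apply: (As q).
Qed.

Lemma monE (I : monomialIdeal) f :
  f \in I <-> {in msupp f, forall m, 'X_[m] \in I}.
Proof.
split=> [fI m|H]; first exact: mon_msupp.
rewrite [f]mpolyE big_seq; apply: rpred_sum => m /H mI.
by rewrite -mul_mpolyC; apply: monMl.
Qed.

Lemma monomial_from_supp (P : {pred {mpoly K[n]}^o}) :
  submod_closed P ->
  (forall f m, f \in P -> m \in msupp f -> 'X_[m] \in P) ->
  exists A, generated_by P A.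
Proof.
move=> [P0 PZ] Psupp; exists (fun m => ('X_[m] : {mpoly K[n]}) \in P) => f; split=> [fP|].
  exists [seq (f@_m *: 1, m) | m <- msupp f].
    by move=> q /mapP[m mf ->] /=; apply: Psupp mf.
  rewrite big_map [LHS]mpolyE; apply: eq_bigr => m _ /=.
  by rewrite -scalerAl mul1r.
case=> s + ->; elim: s => [|q s IHs] As; first by rewrite big_nil.
rewrite big_cons; apply: PZ; first by apply: As; rewrite mem_head.
by apply: IHs => r rs; apply: As; rewrite inE rs orbT.
Qed.

(* (I : J) *)
Definition colon_mem (I J : monomialIdeal) : {pred {mpoly K[n]}^o} :=
  fun f => `[< forall g, g \in J -> f * g \in I >].

Lemma colon_memP (I J : monomialIdeal) : exists A, generated_by (colon_mem I J) A.
Proof.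
have cP f : (f \in colon_mem I J) <-> (forall g, g \in J -> f * g \in I).
  by split=> /asboolP.
apply: monomial_from_supp.
  split=> [|a f g /cP fI /cP gI]; apply/cP => h hJ.
    by rewrite mul0r; apply: rpred0.
  rewrite mulrDl -mulrA; apply: rpredD; last exact: gI.
  by apply: monMl; apply: fI.
move=> f m /cP fI mf; apply/cP => g gJ.
rewrite [g]mpolyE mulr_sumr big_seq; apply: rpred_sum => m' m'g.
rewrite -scalerAr -mul_mpolyC; apply: monMl.
rewrite -mpolyXD; apply: (mon_msupp (f := f * 'X_[m'])).
  by apply: fI; apply: mon_msupp gJ m'g.
by rewrite (perm_mem (msuppMX _ _)) addmC; apply/mapP; exists m.
Qed.

Definition colon (I J : monomialIdeal) : monomialIdeal :=
  MonomialIdeal (colon_memP I J).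

(* (I : u), for the monomial u = 'X_[m] *)
Definition colonX_mem (I : monomialIdeal) (m : 'X_{1..n}) :
  {pred {mpoly K[n]}^o} := fun f => f * 'X_[m] \in I.

Lemma colonX_memP (I : monomialIdeal) m :
  exists A, generated_by (colonX_mem I m) A.
Proof.
apply: monomial_from_supp.
  split=> [|a f g fI gI]; rewrite unfold_in /colonX_mem.
    by rewrite mul0r; apply: rpred0.
  by rewrite mulrDl -mulrA; apply: rpredD => //; apply: monMl.
move=> f m' fI m'f; rewrite unfold_in /colonX_mem -mpolyXD.
apply: (mon_msupp fI).
by rewrite (perm_mem (msuppMX _ _)) addmC; apply/mapP; exists m'.
Qed.

Definition colonX (I : monomialIdeal) (m : 'X_{1..n}) : monomialIdeal :=
  MonomialIdeal (colonX_memP I m).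

End MonomialIdeals.

Arguments monomialIdeal : clear implicits.

Section Modules.
Context {K : fieldType} {n : nat} (I : monomialIdeal K n).

Record idealMod := IdealMod {
  ideal_val : {mpoly K[n]}^o;
  ideal_valP : ideal_val \in I
}.
HB.instance Definition _ := [isSub for ideal_val].
HB.instance Definition _ := [Choice of idealMod by <:].
HB.instance Definition _ := [SubChoice_isSubLmodule of idealMod by <:].

Lemma mon_zmod_closed : zmod_closed (mon_mem I).
Proof.
have [I0 IZ] := mon_submod_closed I; split=> // f g fI gI.
by have := IZ (-1) g f gI fI; rewrite scaleN1r addrC.
Qed.

HB.instance Definition _ :=
  GRing.isZmodClosed.Build {mpoly K[n]}^o (mon_mem I) mon_zmod_closed.

Definition quotMod := {ideal_quot (mon_mem I)}.
HB.instance Definition _ := GRing.Zmodule.on quotMod.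

Definition quot_pi (f : {mpoly K[n]}) : quotMod := \pi_({ideal_quot (mon_mem I)}) f.

Lemma quot_piP f g : (quot_pi f = quot_pi g) <-> (f - g \in I).
Proof.
rewrite /quot_pi; split=> [/eqP|H]; first by rewrite -Quotient.idealrBE.
by apply/eqP; rewrite -Quotient.idealrBE.
Qed.

Lemma quot_piK (x : quotMod) : quot_pi (repr x) = x.
Proof. exact: reprK. Qed.

Lemma quot_piB : zmod_morphism quot_pi.
Proof. exact: pi_is_zmod_morphism. Qed.

Definition quot_scale (p : {mpoly K[n]}) (x : quotMod) : quotMod :=
  quot_pi (p * repr x).

Lemma quot_scaleE p f : quot_scale p (quot_pi f) = quot_pi (p * f).
Proof.
apply/quot_piP; rewrite -mulrBr; apply: monMl.
by apply/quot_piP; rewrite quot_piK.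
Qed.

Lemma quot_piD f g : quot_pi (f + g) = quot_pi f + quot_pi g.
Proof. exact: (raddfD (\pi_({ideal_quot (mon_mem I)}))). Qed.

Lemma quot_scaleA a b x : quot_scale a (quot_scale b x) = quot_scale (a * b) x.
Proof. by rewrite -[x]quot_piK !quot_scaleE mulrA. Qed.

Lemma quot_scale1 : left_id 1 quot_scale.
Proof. by move=> x; rewrite -[x]quot_piK quot_scaleE mul1r. Qed.

Lemma quot_scaleDr : right_distributive quot_scale +%R.
Proof.
move=> a x y; rewrite -[x]quot_piK -[y]quot_piK -quot_piD !quot_scaleE.
by rewrite mulrDr quot_piD.
Qed.

Lemma quot_scaleDl x : {morph quot_scale^~ x : a b / a + b}.
Proof.
by move=> a b; rewrite -[x]quot_piK !quot_scaleE mulrDl quot_piD.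
Qed.

HB.instance Definition _ :=
  GRing.Zmodule_isLmodule.Build {mpoly K[n]} quotMod
    quot_scaleA quot_scale1 quot_scaleDr quot_scaleDl.

Lemma quot_piZ p f : p *: quot_pi f = quot_pi (p * f).
Proof. exact: quot_scaleE. Qed.

End Modules.

Section Gradings.
Context {K : fieldType} {n : nat}.
Implicit Types (f g p : {mpoly K[n]}) (a b : 'rV[int]_n).

Definition zdeg (m : 'X_{1..n}) : 'rV[int]_n := \row_i (m i)%:Z.

(* K-subspaces M_a, a \in Z^n, with x^m M_a \subset M_(a + zdeg m) and
   M = \bigoplus_a M_a. *)
Record znGrading (M : lmodType {mpoly K[n]}) := ZnGrading {
  zcomp : 'rV[int]_n -> M -> Prop;
  zcomp0 : forall a, zcomp a 0;
  zcompD : forall a x y, zcomp a x -> zcomp a y -> zcomp a (x + y);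
  zcompZ : forall a (c : K) x, zcomp a x -> zcomp a (c%:MP *: x);
  zcompX : forall a (m : 'X_{1..n}) x, zcomp a x ->
    zcomp (a + zdeg m) ('X_[m] *: x);
  zcomp_span : forall x, exists s : seq 'rV[int]_n, exists2 y : 'rV[int]_n -> M,
    (forall a, zcomp a (y a)) & x = \sum_(a <- s) y a;
  zcomp_free : forall (s : seq 'rV[int]_n) (y : 'rV[int]_n -> M), uniq s ->
    (forall a, zcomp a (y a)) -> \sum_(a <- s) y a = 0 ->
    forall a, a \in s -> y a = 0
}.

Definition zhomog a f : Prop := forall m, m \in msupp f -> zdeg m = a.

Definition hpart a f : {mpoly K[n]} :=
  \sum_(m <- msupp f | zdeg m == a) f@_m *: 'X_[m].

Lemma zdegD m m' : zdeg (m + m')%MM = zdeg m + zdeg m'.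
Proof. by apply/rowP=> i; rewrite !mxE mnmDE PoszD. Qed.

Lemma mcoeff_hpart a f m : (hpart a f)@_m = if zdeg m == a then f@_m else 0.
Proof.
rewrite /hpart raddf_sum /=.
under eq_bigr do rewrite mcoeffZ mcoeffX.
case: (boolP (m \in msupp f)) => [mf|mf].
  case: ifP => mdeg.
    rewrite (big_rem m) //= mdeg eqxx mulr1 big1_seq ?addr0 // => m' /andP[_].
    by rewrite mem_rem_uniq ?msupp_uniq // => /andP[/negPf-> _]; rewrite mulr0.
  by rewrite big1 // => m' md; case: eqP => [e|]; rewrite ?mulr0 // -e md in mdeg *.
rewrite (memN_msupp_eq0 mf) if_same big1_seq // => m' /andP[_ m'f].
by case: eqP => [e|]; rewrite ?mulr0 // -e m'f in mf *.
Qed.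

Lemma zhomogP a f : zhomog a f <-> hpart a f = f.
Proof.
split=> [fa|<- m]; last first.
  by rewrite mcoeff_msupp mcoeff_hpart; case: (zdeg m =P a) => // _; rewrite eqxx.
apply/mpolyP=> m; rewrite mcoeff_hpart; case: ifP => // /eqP mdeg.
by rewrite memN_msupp_eq0 //; apply/negP => /fa.
Qed.

Lemma hpart_homog a f : zhomog a (hpart a f).
Proof. by apply/zhomogP; apply/mpolyP=> m; rewrite !mcoeff_hpart; case: ifP => [->|]. Qed.

Lemma hpartD a f g : hpart a (f + g) = hpart a f + hpart a g.
Proof.
apply/mpolyP=> m; rewrite mcoeffD !mcoeff_hpart mcoeffD.
by case: ifP; rewrite ?addr0.
Qed.

Lemma hpart0 a : hpart a 0 = 0.
Proof. by rewrite /hpart msupp0 big_nil. Qed.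

Lemma hpart_neq a b f : zhomog b f -> b != a -> hpart a f = 0.
Proof.
move=> fb ab; rewrite /hpart big1_seq // => m /andP[/eqP ma /fb mb].
by rewrite -ma mb eqxx in ab.
Qed.

Lemma hpart_sum s (y : 'rV[int]_n -> {mpoly K[n]}) a : uniq s ->
  (forall b, zhomog b (y b)) -> a \in s -> hpart a (\sum_(b <- s) y b) = y a.
Proof.
move=> us yh as_; rewrite (big_rem a) //= hpartD (zhomogP _ _).1 //.
rewrite (big_morph _ (hpartD a) (hpart0 a)) big1_seq ?addr0 // => b /=.
by rewrite mem_rem_uniq // inE => /andP[ba _]; apply: hpart_neq (yh b) ba.
Qed.

Lemma hpart_span f : f = \sum_(a <- undup [seq zdeg m | m <- msupp f]) hpart a f.
Proof.
apply/mpolyP=> m; rewrite raddf_sum /=.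
under eq_bigr do rewrite mcoeff_hpart.
have us := undup_uniq [seq zdeg m | m <- msupp f].
case: (boolP (m \in msupp f)) => mf; last first.
  by rewrite (memN_msupp_eq0 mf) big1 // => a _; rewrite if_same.
rewrite (big_rem (zdeg m)) /=; last by rewrite mem_undup map_f.
rewrite eqxx big1_seq ?addr0 // => a /=.
by rewrite mem_rem_uniq // inE eq_sym => /andP[/negPf->].
Qed.

Lemma zhomog0 a : zhomog a 0.
Proof. by move=> m; rewrite msupp0. Qed.

Lemma zhomogD a f g : zhomog a f -> zhomog a g -> zhomog a (f + g).
Proof. by move=> /zhomogP fa /zhomogP ga; apply/zhomogP; rewrite hpartD fa ga. Qed.

Lemma zhomogZ a (c : K) f : zhomog a f -> zhomog a (c%:MP * f).
Proof. by move=> fa m; rewrite mul_mpolyC => /msuppZ_le /fa. Qed.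

Lemma zhomogX a m f : zhomog a f -> zhomog (a + zdeg m) ('X_[m] * f).
Proof.
move=> fa m'; rewrite mulrC (perm_mem (msuppMX _ _)) => /mapP[m'' /fa <- ->].
by rewrite zdegD addrC.
Qed.

Lemma hpart_mem (I : monomialIdeal K n) a f : f \in I -> hpart a f \in I.
Proof.
move=> fI; rewrite /hpart big_seq_cond; apply: rpred_sum => m /andP[mf _].
by rewrite -mul_mpolyC; apply: monMl; apply: mon_msupp mf.
Qed.

Section IdealGrading.
Variable I : monomialIdeal K n.

Definition ideal_comp a (x : idealMod I) : Prop := zhomog a (val x).

Lemma ideal_comp_span (x : idealMod I) :
  exists s : seq 'rV[int]_n, exists2 y : 'rV[int]_n -> idealMod I,
    (forall a, ideal_comp a (y a)) & x = \sum_(a <- s) y a.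
Proof.
exists (undup [seq zdeg m | m <- msupp (val x)]).
exists (fun a => IdealMod (hpart_mem a (ideal_valP x))) => [a|].
  exact: hpart_homog.
by apply: val_inj; rewrite raddf_sum /=; apply: hpart_span.
Qed.

Lemma ideal_comp_free (s : seq 'rV[int]_n) (y : 'rV[int]_n -> idealMod I) :
  uniq s -> (forall a, ideal_comp a (y a)) -> \sum_(a <- s) y a = 0 ->
  forall a, a \in s -> y a = 0.
Proof.
move=> us yh /(congr1 val); rewrite raddf_sum /= => y0 a as_; apply: val_inj.
by rewrite -(hpart_sum us yh as_) y0 hpart0.
Qed.

Definition ideal_grading : znGrading (idealMod I) :=
  @ZnGrading (idealMod I) ideal_comp
    (fun a => zhomog0 a) (fun a x y => @zhomogD a (val x) (val y))
    (fun a c x => @zhomogZ a c (val x)) (fun a m x => @zhomogX a m (val x))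
    ideal_comp_span ideal_comp_free.

Definition quot_comp a (x : quotMod I) : Prop :=
  exists2 f, zhomog a f & x = quot_pi I f.

Lemma quot_pi0 : quot_pi I 0 = 0.
Proof. exact: (raddf0 (\pi_({ideal_quot (mon_mem I)}))). Qed.

Lemma quot_comp0 a : quot_comp a 0.
Proof. by exists 0; [exact: zhomog0 | rewrite quot_pi0]. Qed.

Lemma quot_compD a (x y : quotMod I) :
  quot_comp a x -> quot_comp a y -> quot_comp a (x + y).
Proof.
move=> [f fa ->] [g ga ->]; exists (f + g); first exact: zhomogD.
by rewrite quot_piD.
Qed.

Lemma quot_compZ a (c : K) (x : quotMod I) :
  quot_comp a x -> quot_comp a (c%:MP *: x).
Proof.
move=> [f fa ->]; exists (c%:MP * f); first exact: zhomogZ.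
by rewrite quot_piZ.
Qed.

Lemma quot_compX a (m : 'X_{1..n}) (x : quotMod I) :
  quot_comp a x -> quot_comp (a + zdeg m) ('X_[m] *: x).
Proof.
move=> [f fa ->]; exists ('X_[m] * f); first exact: zhomogX.
by rewrite quot_piZ.
Qed.

Lemma quot_pi_sum T (s : seq T) (y : T -> {mpoly K[n]}) :
  quot_pi I (\sum_(a <- s) y a) = \sum_(a <- s) quot_pi I (y a).
Proof. exact: (big_morph _ (@quot_piD _ _ I) quot_pi0). Qed.

Lemma quot_comp_span (x : quotMod I) :
  exists s : seq 'rV[int]_n, exists2 y : 'rV[int]_n -> quotMod I,
    (forall a, quot_comp a (y a)) & x = \sum_(a <- s) y a.
Proof.
exists (undup [seq zdeg m | m <- msupp (repr x : {mpoly K[n]})]).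
exists (fun a => quot_pi I (hpart a (repr x))) => [a|].
  by exists (hpart a (repr x)) => //; apply: hpart_homog.
by rewrite -quot_pi_sum -hpart_span quot_piK.
Qed.

Lemma quot_comp_free (s : seq 'rV[int]_n) (y : 'rV[int]_n -> quotMod I) :
  uniq s -> (forall a, quot_comp a (y a)) -> \sum_(a <- s) y a = 0 ->
  forall a, a \in s -> y a = 0.
Proof.
move=> us yh.
have /choice[z zP] a : exists f, zhomog a f /\ y a = quot_pi I f.
  by have [f fa ->] := yh a; exists f.
rewrite (eq_bigr (fun a => quot_pi I (z a))) => [|a _]; last exact: (zP a).2.
rewrite -quot_pi_sum -quot_pi0 => /quot_piP; rewrite subr0 => zI a as_.
rewrite (zP a).2; apply/quot_piP; rewrite subr0.
by rewrite -(hpart_sum us (fun b => (zP b).1) as_); apply: hpart_mem.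
Qed.

Definition quot_grading : znGrading (quotMod I) :=
  ZnGrading quot_comp0 quot_compD quot_compZ quot_compX
    quot_comp_span quot_comp_free.

End IdealGrading.
End Gradings.

Section StanleyDepth.
Context {K : fieldType} {n : nat} {M : lmodType {mpoly K[n]}}.
Variable gr : znGrading M.

(* p \in K[Z] *)
Definition poly_in (Z : {set 'I_n}) (p : {mpoly K[n]}) : Prop :=
  forall m, m \in msupp p -> forall i, i \notin Z -> m i = 0%N.

Record stanleyDecomposition := StanleyDecomposition {
  sd_size : nat;
  sd_gen : 'I_sd_size -> M;
  sd_vars : 'I_sd_size -> {set 'I_n};
  sd_homog : forall i, exists a, zcomp gr a (sd_gen i);
  sd_free : forall i p, poly_in (sd_vars i) p -> p *: sd_gen i = 0 -> p = 0;
  sd_direct : forall x : M, exists! v : {ffun 'I_sd_size -> M},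
    (forall i, exists2 p, poly_in (sd_vars i) p & v i = p *: sd_gen i) /\
    x = \sum_i v i
}.

(* min_i |Z_i|: each |Z_i| is at most n, and the index set is nonempty as soon
   as M is nonzero. *)
Definition sdepth_dec (D : stanleyDecomposition) : nat :=
  \big[minn/n]_(i < sd_size D) #|sd_vars i|.

(* The maximum of sdepth_dec D over all decompositions D; all its values are at
   most n. *)
Definition sdepth : nat :=
  \max_(d < n.+1 | `[< exists D : stanleyDecomposition, sdepth_dec D = d >]) d.

End StanleyDepth.

Definition sdepth_ideal (K : fieldType) (n : nat) (I : monomialIdeal K n) : int :=
  (sdepth (ideal_grading I))%:Z.

Definition sdepth_quot (K : fieldType) (n : nat) (I : monomialIdeal K n) : int :=
  (sdepth (quot_grading I))%:Z.

(* The minimum of a nonempty finite family of integers (0 if k = 0): folding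
   from the first element F 0 leaves the minimum unchanged. *)
Definition fmin (k : nat) (F : 'I_k -> int) : int :=
  \big[Order.min/head 0 (codom F)]_(i < k) F i.

(* Main.v *)
Require Import Defs.
From mathcomp Require Import all_boot all_order all_algebra.
From mathcomp Require Import boolp.
From mathcomp Require Import mpoly zify.

Set Implicit Arguments.
Unset Strict Implicit.
Unset Printing Implicit Defensive.

Import Order.TTheory GRing.Theory Num.Theory.
Local Open Scope ring_scope.

(** Both inequalities reduce to the combinatorics of sets of monomials.

    The ideal [I] and the quotient [S/I] have [K]-bases indexed by sets of
    monomials: those in [I], and those outside [I].  All their homogeneous
    elements are multiples of basis elements, so a Stanley decomposition
    [M = \bigoplus m_i K[Z_i]] is the same thing as a partition of the index set
    into finitely many boxes [a_i + N^(Z_i)].  The lemmas [boxed_codepth] and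
    [codepth_boxed] state this equivalence, for any module that has a
    [monModel], that is, which looks like polynomials supported in a set [P] of
    monomials and multiplied modulo the monomials outside [P].

    The statements become additive in terms of the codepth [n - sdepth]: let
    [boxed c P] mean that the set [P] of monomials is partitioned into finitely
    many boxes with [n - |Z| <= c].  Then
    - translating by a monomial keeps the bound, because the preimage of a box
      is empty or a box with the same [Z] ([boxed_shift]); this compares
      [(I : u)] with [I], and [S/(I : u)] with [S/I];
    - intersecting adds the bounds, because two boxes with variables [Z] and [W]
      meet in the empty set or in a box with variables [Z :&: W] ([boxedI]);
    - disjoint unions take the larger bound ([boxedU]).
    As [(I : J)] is the intersection of the [(I : u_i)] ([colon_monomials]), part
    (1) is the intersection rule.  For part (2), sort the monomials outside
    [(I : J)] by the first [i] for which they are outside [(I : u_i)]: the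
    [i]-th piece is the complement of [(I : u_i)] intersected with the
    [(I : u_j)], [j < i] ([boxedC_forall]).

    The empty maximum is 0, so [sdepth] directly yields a decomposition only when
    it is positive.  This is enough: if one of the depths
    used vanishes, the corresponding codepth is [n] and the claimed bound is
    trivial. *)

(** * Partitions of sets of monomials into boxes *)

Section Boxes.
Context {n : nat}.
Implicit Types (m : 'X_{1..n}) (P Q : pred 'X_{1..n}).

(** The pair [(a, Z)] stands for [a + N^Z], the exponents of the monomials of
    [x^a K[Z]]. *)
Definition box : Type := 'X_{1..n} * {set 'I_n}.
Implicit Types (b : box) (s t : seq box) (c : nat).

Definition mem_box b : pred 'X_{1..n} := fun m =>
  [forall i, if i \in b.2 then (b.1 i <= m i)%N else m i == b.1 i].

Definition codim_le c s := all (fun b => (#|~: b.2| <= c)%N) s.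

(** Counting the boxes that contain [m] makes coverage and disjointness a single
    equation: the count is 1 on [P] and 0 elsewhere. *)
Definition boxed c P : Prop :=
  exists2 s, codim_le c s & forall m, count (mem_box^~ m) s = P m.

Lemma mem_boxP b m :
  reflect (exists2 m' : 'X_{1..n}, (forall i, i \notin b.2 -> m' i = 0%N)
             & m = (b.1 + m')%MM)
          (mem_box b m).
Proof.
apply: (iffP forallP) => [bm|[m' m'0 ->] i]; last first.
  rewrite mnmDE; case: ifP => [_|/negbT/m'0 ->]; first exact: leq_addr.
  by rewrite addn0.
exists (m - b.1)%MM => [i|]; last first.
  apply/mnmP=> i; rewrite mnmDE mnmBE subnKC //.
  by have := bm i; case: ifP => // _ /eqP ->.
by move=> iZ; have := bm i; rewrite mnmBE (negPf iZ) => /eqP ->; rewrite subnn.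
Qed.

Lemma mem_box_corner b : mem_box b b.1.
Proof. by apply/mem_boxP; exists 0%MM => [i|]; rewrite ?mnm0E ?addm0. Qed.

Lemma boxed_le c c' P : (c <= c')%N -> boxed c P -> boxed c' P.
Proof.
move=> cc' [s sc sP]; exists s => //.
by apply: sub_all sc => b /leq_trans; apply.
Qed.

Lemma eq_boxed c P Q : P =1 Q -> boxed c P -> boxed c Q.
Proof. by move=> PQ [s sc sP]; exists s => // m; rewrite sP PQ. Qed.

Lemma boxed_pred0 c : boxed c pred0.
Proof. by exists [::]. Qed.

(** The whole of [N^n] is a single box; it starts the intersection of finitely
    many sets. *)
Lemma boxed_predT : boxed 0 predT.
Proof.
exists [:: (0%MM, setT)] => [|m] /=; first by rewrite /codim_le /= setCT cards0.
have -> // : mem_box (0%MM, setT) m = true.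
by apply/forallP => i; rewrite inE mnm0E.
Qed.

Lemma boxedU c P Q : (forall m, ~~ (P m && Q m)) ->
  boxed c P -> boxed c Q -> boxed c (predU P Q).
Proof.
move=> disj [s sc sP] [t tc tQ]; exists (s ++ t) => [|m].
  by rewrite /codim_le all_cat; apply/andP.
by rewrite count_cat sP tQ /=; case: (P m) (Q m) (disj m) => [] [].
Qed.

(** Multiplicities of boxes are additive, so a partition can be transformed one
    box at a time.  The map [h] is a translation for colon ideals; it is the
    identity, with [Q] a second boxed set, for intersections. *)
Lemma boxed_refine c d P Q (h : 'X_{1..n} -> 'X_{1..n}) :
  (forall b, (#|~: b.2| <= c)%N -> boxed d (fun m => mem_box b (h m) && Q m)) ->
  boxed c P -> boxed d (fun m => P (h m) && Q m).
Proof.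
move=> bd [s sc sP].
suff [t td tE] : exists2 t, codim_le d t
    & forall m, count (mem_box^~ m) t = (count (mem_box^~ (h m)) s * Q m)%N.
  by exists t => // m; rewrite tE sP mulnb.
elim: s sc {sP} => [_|b s IHs /andP[bc /IHs[t td tE]]]; first by exists [::].
have [t' t'd t'E] := bd b bc; exists (t' ++ t) => [|m].
  by rewrite /codim_le all_cat; apply/andP.
by rewrite count_cat t'E tE /= mulnDl mulnb.
Qed.

Lemma boxed_box1 b c P : mem_box b =1 P -> (#|~: b.2| <= c)%N -> boxed c P.
Proof.
move=> bP bc; exists [:: b] => [|m]; first by rewrite /codim_le /= bc.
by rewrite /= bP addn0.
Qed.

(** Coordinatewise, [m + u >= a] means [m >= a - u] with truncated subtraction,
    while [m + u = a] means [m = a - u] when [u <= a] and has no solution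
    otherwise. *)
Lemma boxed_shift c P u : boxed c P -> boxed c (fun m => P (m + u)%MM).
Proof.
move=> Pc.
apply: (@eq_boxed _ (fun m => P (m + u)%MM && predT m)) => [m|].
  by rewrite andbT.
apply: boxed_refine Pc => b bc.
pose b' : box := ((b.1 - u)%MM, b.2).
have bE m i : (i \in b.2 -> (b'.1 i <= m i) = (b.1 i <= (m + u)%MM i))%N.
  by rewrite mnmDE mnmBE leq_subLR addnC.
case: (boolP [forall (i | i \notin b.2), u i <= b.1 i]%N) => [/forallP ub|].
  apply: (@boxed_box1 b') => // m; rewrite andbT; apply: eq_forallb => i /=.
  case: ifP => [/(bE m)//|iZ]; have := ub i.
  rewrite iZ mnmDE mnmBE /= => uib.
  by rewrite -(eqn_add2r (u i)) subnK.
move=> /forallPn[i]; rewrite negb_imply -ltnNge => /andP[iZ ui].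
apply: eq_boxed (boxed_pred0 c) => m; rewrite andbT.
apply/esym/forallP => /(_ i); rewrite (negPf iZ) mnmDE => /eqP e.
by move: ui; rewrite -e ltnNge leq_addl.
Qed.

(** If the boxes meet, their intersection has the componentwise maximum of the
    two corners as its corner; they meet exactly when this monomial lies in
    both. *)
Lemma boxed_boxI b1 b2 c : (#|~: b1.2| + #|~: b2.2| <= c)%N ->
  boxed c (predI (mem_box b1) (mem_box b2)).
Proof.
move=> bc.
pose b : box := ([multinom maxn (b1.1 i) (b2.1 i) | i < n], b1.2 :&: b2.2).
have bcod : (#|~: b.2| <= c)%N.
  by rewrite setCI; apply: leq_trans bc; rewrite leq_card_setU.
case: (boolP (mem_box b1 b.1 && mem_box b2 b.1)) => [/andP[]|disj].
  move=> /forallP b1b /forallP b2b; apply: (@boxed_box1 b) => // m.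
  apply/forallP/andP => [bm|[/forallP b1m /forallP b2m] i].
    split; apply/forallP => i; move: (bm i) (b1b i) (b2b i);
      rewrite /= !inE !mnmE; case: (i \in b1.2) => /=;
      case: (i \in b2.2) => //=; lia.
  move: (b1m i) (b2m i) (b1b i) (b2b i); rewrite /= !inE !mnmE.
  by case: (i \in b1.2) => /=; case: (i \in b2.2) => //=; lia.
apply: eq_boxed (boxed_pred0 c) => m; apply/esym/negP => /andP[].
move=> /forallP b1m /forallP b2m; case/negP: disj.
apply/andP; split; apply/forallP => i; move: (b1m i) (b2m i);
  rewrite /= !mnmE; case: (i \in b1.2) => /=; case: (i \in b2.2) => //=; lia.
Qed.

Lemma boxedI c d P Q : boxed c P -> boxed d Q -> boxed (c + d) (predI P Q).
Proof.
move=> Pc Qd; apply: boxed_refine (id) _ Pc => b bc.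
apply: (@eq_boxed _ (fun m => Q m && mem_box b m)) => [m|]; first exact: andbC.
apply: boxed_refine (id) _ Qd => b' b'd.
by apply: boxed_boxI; rewrite addnC leq_add.
Qed.

Lemma forall_ord_recl k (p : pred 'I_k.+1) :
  [forall i, p i] = p ord0 && [forall i, p (lift ord0 i)].
Proof.
apply/forallP/andP => [pT|[p0 /forallP pS] i]; first by split=> //; apply/forallP.
by have [j ->|->] := unliftP ord0 i.
Qed.

Lemma boxed_forall k (c : 'I_k -> nat) (P : 'I_k -> pred 'X_{1..n}) :
  (forall i, boxed (c i) (P i)) ->
  boxed (\sum_(i < k) c i) (fun m => [forall i, P i m]).
Proof.
elim: k c P => [|k IHk] c P cP.
  apply: eq_boxed (boxed_le (leq0n _) boxed_predT) => m.
  by apply/esym/forallP => -[].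
rewrite big_ord_recl.
apply: eq_boxed (boxedI (cP ord0) (IHk _ _ (fun i => cP (lift ord0 i)))) => m.
by rewrite forall_ord_recl.
Qed.

(** Induction on [k], splitting off the first set: a monomial outside the
    intersection is outside [P 0], or inside [P 0] and outside the intersection
    of the others.  Unfolding the induction, the [i]-th piece is
    [P 0, ..., P (i - 1)] intersected with the complement of [P i]; this is where
    the sums over [j < i] come from. *)
Lemma boxedC_forall k (c d : 'I_k -> nat) C (P : 'I_k -> pred 'X_{1..n}) :
  (forall i, boxed (d i) (predC (P i))) ->
  (forall i j : 'I_k, (j < i)%N -> boxed (c j) (P j)) ->
  (forall i : 'I_k, (d i + \sum_(j < k | (j < i)%N) c j <= C)%N) ->
  boxed C (predC (fun m => [forall i, P i m])).
Proof.
elim: k c d C P => [|k IHk] c d C P dP cP dcC.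
  apply: eq_boxed (boxed_pred0 C) => m /=.
  by apply/esym/negbF/forallP => -[].
pose l := lift (@ord0 k); pose R m := [forall i : 'I_k, P (l i) m].
have PE m : [forall i, P i m] = P ord0 m && R m.
  exact: forall_ord_recl.
apply: (@eq_boxed _ (predU (predC (P ord0)) (predI (P ord0) (predC R)))) => [m|].
  by rewrite /= PE negb_and; case: (P ord0 m).
apply: boxedU => [m||]; first by rewrite /= andbA andNb.
  by apply: boxed_le (dP ord0); apply: leq_trans (dcC ord0); rewrite leq_addr.
(* A bound on [P 0] is available only when another set follows it. *)
have [k0|k_gt0] := posnP k.
  apply: eq_boxed (boxed_pred0 C) => m /=.
  suff -> : R m by rewrite andbF.
  by apply/forallP => i; have := leq_ltn_trans (leq0n i) (ltn_ord i); rewrite k0.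
pose i0 : 'I_k := Ordinal k_gt0.
have cS i : (\sum_(j < k.+1 | (j < l i)%N) c j =
    c ord0 + \sum_(j < k | (j < i)%N) c (l j))%N.
  rewrite big_mkcond big_ord_recl /= [in RHS]big_mkcond /=.
  by congr addn; apply: eq_bigr => j _.
have c0C : (c ord0 <= C)%N.
  by apply: leq_trans (dcC (l i0)); rewrite cS addnCA leq_addr.
rewrite -(subnKC c0C); apply: boxedI (cP (l i0) ord0 isT) _.
apply: (IHk (c \o l) (d \o l) _ (P \o l)) => [i|i j ji|i] /=; first exact: dP.
  exact: (cP (l i)).
by rewrite leq_subRL // addnCA -cS.
Qed.

End Boxes.

(** * Truncated polynomials *)

Section Truncation.
Context {K : fieldType} {n : nat}.
Implicit Types (f g p : {mpoly K[n]}) (P : pred 'X_{1..n}).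

Definition mtrunc P f : {mpoly K[n]} :=
  \sum_(m <- msupp f | P m) f@_m *: 'X_[m].

Lemma mcoeff_mtrunc P f m : (mtrunc P f)@_m = if P m then f@_m else 0.
Proof.
rewrite /mtrunc raddf_sum /=.
under eq_bigr do rewrite mcoeffZ mcoeffX.
have [mf|mf] := boolP (m \in msupp f).
  rewrite big_mkcond (bigD1_seq m) ?msupp_uniq //= eqxx mulr1.
  by rewrite big1 ?addr0 // => m' /negPf ->; rewrite mulr0 if_same.
rewrite (memN_msupp_eq0 mf) if_same big1_seq // => m' /andP[_ m'f].
by case: eqP => [e|]; rewrite ?mulr0 // -e m'f in mf *.
Qed.

Lemma mtrunc_id P f : (forall m, m \in msupp f -> P m) -> mtrunc P f = f.
Proof.
move=> fP; apply/mpolyP => m; rewrite mcoeff_mtrunc.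
case: ifPn => // Pm; rewrite memN_msupp_eq0 //.
by apply: contra Pm; apply: fP.
Qed.

Lemma mtruncD P f g : mtrunc P (f + g) = mtrunc P f + mtrunc P g.
Proof.
by apply/mpolyP => m; rewrite mcoeffD !mcoeff_mtrunc mcoeffD; case: ifP; rewrite ?addr0.
Qed.

Lemma msupp_mtrunc P f m : m \in msupp (mtrunc P f) -> P m.
Proof. by rewrite mcoeff_msupp mcoeff_mtrunc; case: ifP; rewrite ?eqxx. Qed.

Lemma mpolyX_neq0 m : 'X_[m] != 0 :> {mpoly K[n]}.
Proof. by rewrite -msupp_eq0 msuppX. Qed.

Lemma zdeg_inj : injective (@zdeg n).
Proof. by move=> m m' /rowP e; apply/mnmP => i; have := e i; rewrite !mxE => -[]. Qed.

(** The [Z^n]-graded pieces of the polynomial ring have dimension at most 1. *)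
Lemma zhomog_monomial (a : 'rV[int]_n) f : zhomog a f -> f != 0 ->
  exists2 cm : K * 'X_{1..n}, cm.1 != 0 & f = cm.1 *: 'X_[cm.2].
Proof.
move=> fa f0; exists (mleadc f, mlead f); first by rewrite mleadc_eq0.
rewrite /= [LHS]mpolyE (bigD1_seq (mlead f)) ?msupp_uniq ?mlead_supp //=.
rewrite big1_seq ?addr0 // => m /andP[/negP ml mf]; case: ml.
by apply/eqP/zdeg_inj; rewrite !fa // mlead_supp.
Qed.

Lemma poly_inX (b : @box n) m : mem_box b m ->
  exists2 m', poly_in b.2 ('X_[m'] : {mpoly K[n]}) & m = (m' + b.1)%MM.
Proof.
case/mem_boxP => m' m'Z ->; exists m'; last by rewrite addmC.
by move=> m''; rewrite msuppX inE => /eqP ->.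
Qed.

Lemma msuppMX_box (b : @box n) p m : poly_in b.2 p ->
  m \in msupp (p * 'X_[b.1]) -> mem_box b m.
Proof.
move=> pZ; rewrite (perm_mem (msuppMX _ _)) => /mapP[m' m'p ->].
by apply/mem_boxP; exists m' => // i; apply: pZ.
Qed.

(** The part of [f] in the box [a + N^Z] belongs to [x^a K[Z]]. *)
Lemma mtrunc_box (b : @box n) f :
  exists2 p, poly_in b.2 p & mtrunc (mem_box b) f = p * 'X_[b.1].
Proof.
have bsub m : mem_box b m -> (m - b.1 + b.1)%MM = m.
  by case/mem_boxP => m' _ ->; rewrite [(b.1 + m')%MM]addmC addmK.
exists (\sum_(m <- msupp f | mem_box b m) f@_m *: 'X_[m - b.1]).
  move=> m /msupp_sum_le /flattenP[c /mapP[m']].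
  rewrite mem_filter => /andP[bm' _] -> /msuppZ_le; rewrite msuppX inE => /eqP ->.
  have [m'' m''Z ->] := mem_boxP _ _ bm'; rewrite [(b.1 + m'')%MM]addmC addmK => i iZ.
  exact: m''Z.
rewrite mulr_suml; apply: eq_bigr => m bm.
by rewrite -scalerAl -mpolyXD bsub.
Qed.

End Truncation.

(** * Stanley decompositions are partitions into boxes *)

Section MonomialModels.
Context {K : fieldType} {n : nat} {M : lmodType {mpoly K[n]}}.

(** The common shape of a monomial ideal and of its quotient: as a graded vector
    space, [M] is the space of polynomials with support in [P], and [S] acts by
    multiplication followed by deletion of the terms outside [P].  For the
    quotient, [normal_form] takes the representative made of standard
    monomials. *)
Record monModel (gr : znGrading M) (P : pred 'X_{1..n}) := MonModel {
  normal_form : M -> {mpoly K[n]};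
  from_normal_form : {mpoly K[n]} -> M;
  nfK : cancel normal_form from_normal_form;
  from_normal_formK : forall f, normal_form (from_normal_form f) = mtrunc P f;
  nfD : {morph normal_form : x y / x + y};
  nfZ : forall p x, normal_form (p *: x) = mtrunc P (p * normal_form x);
  nf_homog : forall a x, zcomp gr a x <-> zhomog a (normal_form x)
}.

Context {gr : znGrading M} {P : pred 'X_{1..n}} (mod : monModel gr P).
Local Notation nf := (normal_form mod).
Local Notation of_poly := (from_normal_form mod).

Lemma nf_inj : injective nf.
Proof. exact: can_inj (nfK mod). Qed.

Lemma nf0 : nf 0 = 0.
Proof. by apply: (addrI (nf 0)); rewrite -nfD !addr0. Qed.

Lemma nf_eq0 x : (nf x == 0) = (x == 0).
Proof. by rewrite -nf0 (inj_eq nf_inj). Qed.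

Lemma nf_sum T (r : seq T) (F : T -> M) :
  nf (\sum_(i <- r) F i) = \sum_(i <- r) nf (F i).
Proof. exact: (big_morph _ (nfD mod) nf0). Qed.

Lemma msupp_nf x m : m \in msupp (nf x) -> P m.
Proof. by rewrite -[x](nfK mod) from_normal_formK => /msupp_mtrunc. Qed.

Lemma nf_of_poly f : (forall m, m \in msupp f -> P m) -> nf (of_poly f) = f.
Proof. by move=> fP; rewrite from_normal_formK mtrunc_id. Qed.

Lemma nf_of_polyX m : P m -> nf (of_poly 'X_[m]) = 'X_[m].
Proof. by move=> Pm; apply: nf_of_poly => m'; rewrite msuppX inE => /eqP ->. Qed.

Section DecompositionToBoxes.
Variable D : stanleyDecomposition gr.
Local Notation gen := (@sd_gen _ _ _ _ D).
Local Notation vars := (@sd_vars _ _ _ _ D).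

(** The generators of a Stanley decomposition are nonzero, by freeness, and
    homogeneous, so they are multiples of basis monomials.  Their exponents are
    the corners of the boxes. *)
Lemma nf_sd_gen : exists (c : 'I_(sd_size D) -> K) (a : 'I_(sd_size D) -> 'X_{1..n}),
  forall i, c i != 0 /\ nf (gen i) = c i *: 'X_[a i].
Proof.
suff /choice[ca caP] : forall i, exists ca : K * 'X_{1..n},
    ca.1 != 0 /\ nf (gen i) = ca.1 *: 'X_[ca.2].
  by exists (fst \o ca), (snd \o ca) => i; apply: caP.
move=> i; have [d gd] := sd_homog i.
have [|ca ca0 gE] := zhomog_monomial ((nf_homog mod _ _).1 gd); last by exists ca.
rewrite nf_eq0; apply/eqP => g0; have /eqP : (1 : {mpoly K[n]}) = 0.
  apply: (@sd_free _ _ _ _ D i); last by rewrite g0 scaler0.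
  by move=> m; rewrite msupp1 inE => /eqP -> j _; rewrite mnm0E.
by rewrite oner_eq0.
Qed.

Variables (c : 'I_(sd_size D) -> K) (a : 'I_(sd_size D) -> 'X_{1..n}).
Hypothesis caP : forall i, c i != 0 /\ nf (gen i) = c i *: 'X_[a i].

Definition sd_box i : box := (a i, vars i).

Lemma nf_scale_sd_gen i p : nf (p *: gen i) = mtrunc P (c i *: (p * 'X_[a i])).
Proof. by rewrite nfZ (caP i).2 -scalerAr. Qed.

Lemma msupp_scale_gen i p m : poly_in (vars i) p ->
  m \in msupp (nf (p *: gen i)) -> mem_box (sd_box i) m.
Proof.
move=> pi; rewrite nf_scale_sd_gen mcoeff_msupp mcoeff_mtrunc.
case: ifP => _; last by rewrite eqxx.
rewrite -mcoeff_msupp => /msuppZ_le; exact: (msuppMX_box (b := sd_box i)).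
Qed.

(** Freeness forces the box inside [P]: were [x^m] deleted, a monomial of
    [K[Z_i]] would kill the generator.  Hence the basis element of exponent [m]
    lies in the [i]-th summand. *)
Lemma mem_sd_boxP i m : mem_box (sd_box i) m ->
  P m /\ exists2 p, poly_in (vars i) p & of_poly 'X_[m] = p *: gen i.
Proof.
move=> /(@poly_inX K) [/= m' m'i ->]; have [c0 _] := caP i.
have Pm : P (m' + a i)%MM.
  apply: contraT => NPm; have g0 : 'X_[m'] *: gen i = 0.
    apply: nf_inj; rewrite nf0 nf_scale_sd_gen; apply/mpolyP => k.
    rewrite mcoeff_mtrunc mcoeff0 -mpolyXD mcoeffZ mcoeffX.
    by case: (_ =P k) => [<-|_]; rewrite ?(negPf NPm) // mulr0 if_same.
  by have /eqP := sd_free m'i g0; rewrite (negPf (mpolyX_neq0 _)).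
split=> //; exists ((c i)^-1 *: 'X_[m']) => [k /msuppZ_le|]; first exact: m'i.
apply: nf_inj; rewrite nf_of_polyX // nf_scale_sd_gen -scalerAl scalerA mulfV //.
rewrite scale1r -mpolyXD mtrunc_id // => k; by rewrite msuppX inE => /eqP ->.
Qed.

Lemma sd_box_cover m : P m -> exists i, mem_box (sd_box i) m.
Proof.
move=> Pm; have [v [[vp vs] _]] := sd_direct D (of_poly 'X_[m]).
have [i vi] : exists i, (nf (v i))@_m != 0.
  apply/existsP; rewrite -negb_forall; apply/negP => /forallP v0.
  have /eqP := congr1 (mcoeff m \o nf) vs.
  rewrite /= nf_of_polyX // nf_sum mcoeffX eqxx raddf_sum big1 ?oner_eq0 //.
  by move=> i _; apply/eqP; rewrite -[_ == _]negbK v0.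
exists i; have [p pi vE] := vp i; apply: (msupp_scale_gen pi).
by rewrite -vE mcoeff_msupp.
Qed.

(** A monomial in two boxes would give an element of [M] with two different
    decompositions, one concentrated in each summand. *)
Lemma sd_box_inj i j m :
  mem_box (sd_box i) m -> mem_box (sd_box j) m -> i = j.
Proof.
move=> im jm; have [Pm _] := mem_sd_boxP im.
have [v [_ vu]] := sd_direct D (of_poly 'X_[m]).
have w k : mem_box (sd_box k) m ->
    v = [ffun l => if l == k then of_poly 'X_[m] else 0].
  move=> /mem_sd_boxP[_ [p pk pE]]; apply: vu; split=> [l|].
    rewrite ffunE; case: eqP => [->|_]; first by exists p.
    by exists 0; rewrite ?scale0r // => k'; rewrite msupp0.
  rewrite (bigD1 k) //= ffunE eqxx big1 ?addr0 // => l /negPf lk.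
  by rewrite ffunE lk.
have := congr1 (fun f : {ffun _ -> M} => nf (f i)) (etrans (esym (w i im)) (w j jm)).
rewrite !ffunE eqxx; case: eqP => // _ /eqP.
by rewrite nf0 nf_of_polyX // (negPf (mpolyX_neq0 _)).
Qed.

End DecompositionToBoxes.

Lemma boxed_of_dec (D : stanleyDecomposition gr) : boxed (n - sdepth_dec D) P.
Proof.
have [c [a caP]] := nf_sd_gen D.
exists [seq sd_box a i | i <- enum 'I_(sd_size D)].
  apply/allP => _ /mapP[i _ ->] /=; rewrite cardsCs setCK card_ord leq_sub2l //.
  by rewrite /sdepth_dec -minEnat -leEnat; apply: bigmin_le.
move=> m; rewrite count_map -sum1_count big_enum_cond /=.
have [Pm|NPm] := boolP (P m); last first.
  by rewrite big1 // => i /(mem_sd_boxP caP)[Pm]; rewrite Pm in NPm.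
have [i im] := sd_box_cover caP Pm.
rewrite (bigD1 i) //= big1 // => j /andP[jm].
by rewrite (sd_box_inj caP jm im) eqxx.
Qed.

(** Conversely, the corners of a partition into boxes generate a Stanley
    decomposition, whose components cut a normal form along the boxes. *)
Section BoxesToDecomposition.
Variable s : seq (@box n).
Hypothesis sP : forall m, count (mem_box^~ m) s = P m.
Local Notation b := (tnth (in_tuple s)).

Lemma tnth_box_sub i m : mem_box (b i) m -> P m.
Proof.
move=> bm; rewrite -[P m]lt0b -(sP m) -has_count; apply/hasP.
by exists (b i) => //; apply: mem_tnth.
Qed.

Lemma tnth_box_cover m : P m -> exists i, mem_box (b i) m.
Proof.
rewrite -[P m]lt0b -(sP m) -has_count => /hasP[x /seq_tnthP[i ->] xm].
by exists i.
Qed.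

Lemma tnth_box_inj i j m : mem_box (b i) m -> mem_box (b j) m -> i = j.
Proof.
move=> im jm; apply/eqP; apply: contraT => ij.
have := leq_b1 (P m); rewrite -(sP m) -sum1_count big_tnth (bigD1 i) //=.
by rewrite (bigD1 j) //= jm eq_sym.
Qed.

Definition box_gen i : M := of_poly 'X_[(b i).1].

Lemma nf_scale_box_gen i p : poly_in (b i).2 p ->
  nf (p *: box_gen i) = p * 'X_[(b i).1].
Proof.
move=> pi; rewrite nfZ /box_gen nf_of_polyX; last exact: tnth_box_sub (mem_box_corner _).
by apply: mtrunc_id => m /(msuppMX_box pi) /tnth_box_sub.
Qed.

Lemma box_gen_homog i : exists d, zcomp gr d (box_gen i).
Proof.
exists (zdeg (b i).1); apply/(nf_homog mod).
rewrite /box_gen nf_of_polyX; last exact: tnth_box_sub (mem_box_corner _).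
by move=> m; rewrite msuppX inE => /eqP ->.
Qed.

Lemma box_gen_free i p : poly_in (b i).2 p -> p *: box_gen i = 0 -> p = 0.
Proof.
move=> pi /(congr1 nf); rewrite nf0 nf_scale_box_gen // => /eqP.
by rewrite mulf_eq0 (negPf (mpolyX_neq0 _)) orbF => /eqP.
Qed.

Lemma box_gen_direct (x : M) : exists! v : {ffun 'I_(size s) -> M},
  (forall i, exists2 p, poly_in (b i).2 p & v i = p *: box_gen i) /\
  x = \sum_i v i.
Proof.
pose v i := of_poly (mtrunc (mem_box (b i)) (nf x)).
have nfv i : nf (v i) = mtrunc (mem_box (b i)) (nf x).
  by apply: nf_of_poly => m /msupp_mtrunc /tnth_box_sub.
exists [ffun i => v i]; split; first split=> [i|].
- rewrite ffunE; have [p pi pE] := mtrunc_box (b i) (nf x).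
  by exists p => //; apply: nf_inj; rewrite nfv pE nf_scale_box_gen.
- apply: nf_inj; rewrite nf_sum; apply/mpolyP => m; rewrite raddf_sum /=.
  under eq_bigr do rewrite ffunE nfv mcoeff_mtrunc.
  have [mx|mx] := boolP (m \in msupp (nf x)); last first.
    by rewrite (memN_msupp_eq0 mx) big1 // => i _; rewrite if_same.
  have [i im] := tnth_box_cover (msupp_nf mx).
  rewrite (bigD1 i) //= im big1 ?addr0 // => j ji; case: ifP => // jm.
  by rewrite (tnth_box_inj jm im) eqxx in ji.
- move=> w [wp xE]; apply/ffunP => i; rewrite ffunE; apply: nf_inj.
  rewrite nfv xE nf_sum; apply/mpolyP => m; rewrite mcoeff_mtrunc raddf_sum /=.
  have wbox j : ~~ mem_box (b j) m -> (nf (w j))@_m = 0.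
    move=> jm; have [p pj ->] := wp j; rewrite nf_scale_box_gen //.
    by apply: memN_msupp_eq0; apply: contra jm => /(msuppMX_box pj).
  case: ifPn => [im|/wbox //].
  rewrite (bigD1 i) //= big1 ?addr0 // => j ji; apply: wbox.
  by apply: contra ji => jm; rewrite (tnth_box_inj jm im).
Qed.

Definition box_dec : stanleyDecomposition gr :=
  StanleyDecomposition box_gen_homog box_gen_free box_gen_direct.

Lemma sdepth_box_dec c : codim_le c s -> (n - c <= sdepth_dec box_dec)%N.
Proof.
move=> /allP sc; rewrite /sdepth_dec -minEnat -leEnat; apply: le_bigmin => [|i _] /=.
  exact: leq_subr.
have := sc _ (mem_tnth i (in_tuple s)); rewrite cardsCs setCK card_ord.
by rewrite !leEnat !leq_subLR addnC.
Qed.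

End BoxesToDecomposition.

Lemma sdepth_dec_le (D : stanleyDecomposition gr) : (sdepth_dec D <= n)%N.
Proof. by rewrite /sdepth_dec -minEnat -leEnat; apply: bigmin_le_id. Qed.

Lemma sdepth_le_dim : (sdepth gr <= n)%N.
Proof. by apply/bigmax_leqP => d _; rewrite -ltnS. Qed.

(** The hypothesis [c < n] makes the depth positive, so that the maximum that
    defines it is attained by a decomposition. *)
Lemma boxed_codepth c : (n - sdepth gr <= c)%N -> (c < n)%N -> boxed c P.
Proof.
move=> sc cn; have s_gt0 : (0 < sdepth gr)%N by lia.
have [D Dd] : exists D : stanleyDecomposition gr, sdepth_dec D = sdepth gr.
  case: (pickP (fun d : 'I_n.+1 => `[< exists D : stanleyDecomposition gr,
      sdepth_dec D = d >])) => [d0 d0P|noD]; last first.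
    by rewrite /sdepth big_pred0 in s_gt0.
  rewrite /sdepth (bigop.bigmax_eq_arg d0 d0P).
  by case: arg_maxnP => // d /asboolP.
by apply: boxed_le sc _; rewrite -Dd; apply: boxed_of_dec.
Qed.

Lemma codepth_boxed c : boxed c P -> (n - sdepth gr <= c)%N.
Proof.
move=> [s sc sP]; have := sdepth_box_dec sP sc.
set D := box_dec sP; have Dn : (sdepth_dec D < n.+1)%N by rewrite ltnS sdepth_dec_le.
move=> nc; rewrite leq_subLR addnC -leq_subLR; apply: leq_trans nc _.
by apply: (bigop.bigmax_sup (Ordinal Dn)) => //; apply/asboolP; exists D.
Qed.

End MonomialModels.

(** * Monomial ideals and their quotients *)

Section IdealModels.
Context {K : fieldType} {n : nat} (I : monomialIdeal K n).
Implicit Types (f g p : {mpoly K[n]}) (P : pred 'X_{1..n}).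

Definition ideal_monomials : pred 'X_{1..n} := fun m => ('X_[m] : {mpoly K[n]}) \in I.

Lemma mtrunc_mem P f : (forall m, P m -> ideal_monomials m) -> mtrunc P f \in I.
Proof. by move=> PI; apply/monE => m /msupp_mtrunc /PI. Qed.

Lemma mtrunc_ideal f : f \in I -> mtrunc ideal_monomials f = f.
Proof. by move=> fI; apply: mtrunc_id => m; apply: mon_msupp. Qed.

Lemma mtrunc_idealC f : f \in I -> mtrunc (predC ideal_monomials) f = 0.
Proof.
move=> fI; apply/mpolyP => m; rewrite mcoeff_mtrunc mcoeff0 /=.
case: ifPn => // mI; apply: memN_msupp_eq0.
by apply: contra mI; apply: mon_msupp.
Qed.

Definition ideal_of_poly f : idealMod I := IdealMod (mtrunc_mem f (fun m => id)).

Fact ideal_of_polyK : cancel val ideal_of_poly.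
Proof. by move=> x; apply: val_inj; rewrite /= mtrunc_ideal // ideal_valP. Qed.

Fact ideal_valZ p (x : idealMod I) : val (p *: x) = mtrunc ideal_monomials (p * val x).
Proof. by rewrite mtrunc_ideal //; apply: monMl; apply: ideal_valP. Qed.

Definition ideal_model : monModel (ideal_grading I) ideal_monomials :=
  @MonModel _ _ _ (ideal_grading I) ideal_monomials val ideal_of_poly
    ideal_of_polyK (fun f => erefl) (fun x y => erefl) ideal_valZ
    (fun a x => conj id id).

Local Notation std := (predC ideal_monomials).

Lemma mtrunc_std_congr f g : f - g \in I -> mtrunc std f = mtrunc std g.
Proof. by move=> fgI; rewrite -[f](subrK g) mtruncD mtrunc_idealC // add0r. Qed.

Lemma mtrunc_std_sub f : f - mtrunc std f \in I.
Proof.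
apply/monE => m; rewrite mcoeff_msupp mcoeffB mcoeff_mtrunc /=.
by case: ifPn => [|/negPn //]; rewrite subrr eqxx.
Qed.

Definition quot_nf (x : quotMod I) : {mpoly K[n]} := mtrunc std (repr x).

Lemma quot_nf_pi f : quot_nf (quot_pi I f) = mtrunc std f.
Proof. by apply: mtrunc_std_congr; apply/quot_piP; rewrite quot_piK. Qed.

Fact quot_nfK : cancel quot_nf (quot_pi I).
Proof.
move=> x; rewrite -[RHS]quot_piK; apply/quot_piP.
by rewrite -opprB rpredN mtrunc_std_sub.
Qed.

Fact quot_nfD : {morph quot_nf : x y / x + y}.
Proof.
move=> x y; rewrite -[x]quot_piK -[y]quot_piK -quot_piD !quot_nf_pi.
exact: mtruncD.
Qed.

Fact quot_nfZ p x : quot_nf (p *: x) = mtrunc std (p * quot_nf x).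
Proof.
rewrite -[x]quot_piK quot_piZ !quot_nf_pi; apply: mtrunc_std_congr.
by rewrite -mulrBr; apply: monMl; apply: mtrunc_std_sub.
Qed.

Fact quot_nf_homog a x : zcomp (quot_grading I) a x <-> zhomog a (quot_nf x).
Proof.
split=> [[f fa ->] m|xa]; last by exists (quot_nf x) => //; rewrite quot_nfK.
rewrite quot_nf_pi mcoeff_msupp mcoeff_mtrunc; case: ifP => _; last by rewrite eqxx.
by rewrite -mcoeff_msupp => /fa.
Qed.

Definition quot_model : monModel (quot_grading I) std :=
  MonModel quot_nfK quot_nf_pi quot_nfD quot_nfZ quot_nf_homog.

End IdealModels.

(** * Codepths of colon ideals *)

Section Colon.
Context {K : fieldType} {n : nat} (I : monomialIdeal K n).

Lemma colonX_monomials u m :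
  ideal_monomials (colonX I u) m = ideal_monomials I (m + u)%MM.
Proof. by rewrite /ideal_monomials mpolyXD. Qed.

(** [(I : J)] is the intersection of the [(I : u_i)], as the [u_i] generate
    [J]. *)
Lemma colon_monomials (J : monomialIdeal K n) k (u : 'I_k -> 'X_{1..n}) m :
  generated_by J (fun m' => exists i, u i = m') ->
  ideal_monomials (colon I J) m = [forall i, ideal_monomials (colonX I (u i)) m].
Proof.
move=> Ju; apply/asboolP/forallP => [mJ i|mu g /Ju[s su ->]].
  apply: mJ; apply/Ju; exists [:: (1, u i)] => [q|]; last by rewrite big_seq1 mul1r.
  by rewrite inE => /eqP ->; exists i.
rewrite mulr_sumr big_seq; apply: rpred_sum => q /su[i <-].
by rewrite mulrCA; apply: monMl; apply: mu.
Qed.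

(** Codepths never exceed [n], so only a bound below [n] has content; here and in
    the bounds below, it makes the depths involved positive, hence attained by
    decompositions. *)
Lemma codepth_ideal_colonX u :
  (n - sdepth (ideal_grading (colonX I u)) <= n - sdepth (ideal_grading I))%N.
Proof.
have [cn|] := ltnP (n - sdepth (ideal_grading I)) n; last exact: leq_trans (leq_subr _ _).
apply: (codepth_boxed (ideal_model _)).
apply: eq_boxed (boxed_shift u (boxed_codepth (ideal_model I) (leqnn _) cn)).
by move=> m; rewrite colonX_monomials.
Qed.

Lemma codepth_quot_colonX u :
  (n - sdepth (quot_grading (colonX I u)) <= n - sdepth (quot_grading I))%N.
Proof.
have [cn|] := ltnP (n - sdepth (quot_grading I)) n; last exact: leq_trans (leq_subr _ _).
apply: (codepth_boxed (quot_model _)).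
apply: eq_boxed (boxed_shift u (boxed_codepth (quot_model I) (leqnn _) cn)).
by move=> m /=; rewrite colonX_monomials.
Qed.

Context (J : monomialIdeal K n) {k : nat} (u : 'I_k -> 'X_{1..n}).
Hypothesis Ju : generated_by J (fun m => exists i, u i = m).

Lemma codepth_ideal_colon :
  (n - sdepth (ideal_grading (colon I J)) <=
   \sum_(i < k) (n - sdepth (ideal_grading (colonX I (u i)))))%N.
Proof.
pose c i := (n - sdepth (ideal_grading (colonX I (u i))))%N.
have [cn|] := ltnP (\sum_(i < k) c i)%N n; last first.
  exact: leq_trans (leq_subr _ _).
apply: (codepth_boxed (ideal_model _)).
apply: (@eq_boxed _ _ (fun m => [forall i, ideal_monomials (colonX I (u i)) m])).
  by move=> m; rewrite (colon_monomials _ Ju).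
apply: boxed_forall => i; apply: (boxed_codepth (ideal_model _)) => //.
by apply: leq_ltn_trans cn; rewrite (bigD1 i) //= leq_addr.
Qed.

Lemma codepth_quot_colon c :
  (forall i : 'I_k, n - sdepth (quot_grading (colonX I (u i))) +
     \sum_(j < k | (j < i)%N) (n - sdepth (ideal_grading (colonX I (u j)))) <= c)%N ->
  (n - sdepth (quot_grading (colon I J)) <= c)%N.
Proof.
move=> bound; have [cn|] := ltnP c n; last exact: leq_trans (leq_subr _ _).
apply: (codepth_boxed (quot_model _)).
apply: (@eq_boxed _ _
  (predC (fun m => [forall i, ideal_monomials (colonX I (u i)) m]))).
  by move=> m; rewrite /= (colon_monomials _ Ju).
apply: (boxedC_forall _ _ bound) => [i|i j ji].
  apply: (boxed_codepth (quot_model _)) => //.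
  by apply: leq_ltn_trans cn; apply: leq_trans (bound i); rewrite leq_addr.
apply: (boxed_codepth (ideal_model _)) => //.
apply: leq_ltn_trans cn; apply: leq_trans (bound i).
by rewrite (bigD1 j) //= addnCA leq_addr.
Qed.

End Colon.

(** * From codepths to depths *)

Lemma fmin_geP k (F : 'I_k -> int) (x : int) : (0 < k)%N ->
  reflect (forall i, x <= F i) (x <= fmin F).
Proof.
move=> k_gt0; apply: (iffP (bigmin_geP _ _ _ _)) => [[_ xF] i|xF]; first exact: xF.
(* The initial value of the fold is [F 0], so it is bounded like the others. *)
split=> //; rewrite codomE; case: k k_gt0 F xF => // k _ F xF.
by rewrite enum_ordSl /=.
Qed.

Lemma sum_codepth n k (P : pred 'I_k) (s : 'I_k -> nat) : (forall i, (s i <= n)%N) ->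
  ((\sum_(i | P i) (n - s i))%N)%:Z = n%:Z * #|P|%:Z - \sum_(i | P i) (s i)%:Z.
Proof.
move=> sn; rewrite (big_morph Posz PoszD erefl).
under eq_bigr do rewrite -subzn //.
by rewrite sumrB sumr_const -mulr_natr natz.
Qed.

Lemma card_ord_lt k (i : 'I_k) : #|[pred j : 'I_k | (j < i)%N]| = i.
Proof.
rewrite -sum1_card -(big_ord_widen _ (fun=> 1%N)) ?sum1_card ?card_ord //.
exact: ltnW.
Qed.

(* The generators are u 0, ..., u (k - 1), so that n(i-1) reads n * i below. *)
Theorem corollary2p12 (K : fieldType) (n : nat) (I J : monomialIdeal K n)
    (I_neq0 : nonzero_ideal I) (J_neq0 : nonzero_ideal J)
    (k : nat) (u : 'I_k -> 'X_{1..n}) (u_inj : injective u)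
    (u_gens : is_min_mon_gens J (fun m => exists i, u i = m)) :
  (sdepth_ideal (colon I J) >=
     \sum_(i < k) sdepth_ideal (colonX I (u i)) - n%:Z * (k%:Z - 1)
   /\
   \sum_(i < k) sdepth_ideal (colonX I (u i)) - n%:Z * (k%:Z - 1) >=
     k%:Z * sdepth_ideal I - n%:Z * (k%:Z - 1))
  /\
  ((forall i, ~ ('X_[u i] \in I)) ->
   sdepth_quot (colon I J) >=
     fmin (fun i : 'I_k => sdepth_quot (colonX I (u i))
             + \sum_(j < k | (j < i)%N) sdepth_ideal (colonX I (u j))
             - n%:Z * i%:Z)
   /\
   fmin (fun i : 'I_k => sdepth_quot (colonX I (u i))
             + \sum_(j < k | (j < i)%N) sdepth_ideal (colonX I (u j))
             - n%:Z * i%:Z) >=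
     sdepth_quot I + (k%:Z - 1) * sdepth_ideal I - n%:Z * (k%:Z - 1)).
Proof.
have [Ju _] := u_gens.
have k_gt0 : (0 < k)%N.
  have [f /Ju[s su ->]] := J_neq0; case: s su => [|q s] su.
    by rewrite big_nil eqxx.
  by have [i _ _] := su q (mem_head _ _); apply: leq_ltn_trans (leq0n i) (ltn_ord i).
rewrite /sdepth_ideal /sdepth_quot.
set sI := sdepth (ideal_grading I); set sQ := sdepth (quot_grading I).
set s := fun i => sdepth (ideal_grading (colonX I (u i))).
set q := fun i => sdepth (quot_grading (colonX I (u i))).
have sn i : (s i <= n)%N by apply: sdepth_le_dim.
have qn i : (q i <= n)%N by apply: sdepth_le_dim.
have sIn : (sI <= n)%N by apply: sdepth_le_dim.
have sIs i : sI%:Z <= (s i)%:Z.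
  by have := codepth_ideal_colonX I (u i); rewrite -/sI -/(s i); have := sn i; lia.
have sQq i : sQ%:Z <= (q i)%:Z.
  have := codepth_quot_colonX I (u i); rewrite -/sQ -/(q i); have := qn i.
  by have : (sQ <= n)%N by [apply: sdepth_le_dim]; lia.
have sum_s (P : pred 'I_k) : #|P|%:Z * sI%:Z <= \sum_(i | P i) (s i)%:Z.
  rewrite mulrC -[#|P|%:Z]natz mulr_natr -sumr_const.
  exact: ler_sum.
split; first split.
- have := codepth_ideal_colon I Ju; rewrite -lez_nat (sum_codepth _ sn).
  rewrite card_ord -/s; set A := \sum_(i < k) _; nia.
- by rewrite lerD2r -[in X in X <= _](card_ord k); apply: sum_s.
move=> _; split; last first.
  apply/fmin_geP => // i; have := sum_s [pred j : 'I_k | (j < i)%N].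
  rewrite card_ord_lt; set A := \sum_(j < k | _) _.
  (* The [i]-th bound loses [n - sI] at most [i] times, and [i <= k - 1]. *)
  have : 0 <= (k%:Z - 1 - i%:Z) * (n%:Z - sI%:Z).
    by apply: mulr_ge0; have := ltn_ord i; lia.
  by have := sQq i; rewrite -/(q i); lia.
set m := (X in X <= _).
have mF : forall i, m <= (q i)%:Z + \sum_(j < k | (j < i)%N) (s j)%:Z - n%:Z * i%:Z.
  exact/fmin_geP.
(* The [i]-th term of the minimum is [n] minus the sum of codepths that bounds the
   [i]-th piece of the complement of [(I : J)]. *)
have codF i : ((n - q i) + \sum_(j < k | (j < i)%N) (n - s j))%N%:Z <= n%:Z - m.
  rewrite PoszD (sum_codepth _ sn) card_ord_lt -subzn //; have := mF i.
  by set A := \sum_(j < k | _) (s j)%:Z; lia.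
have := @codepth_quot_colon _ _ I J k u Ju `|n%:Z - m|%N.
have n_m : 0 <= n%:Z - m by apply: le_trans (codF (Ordinal k_gt0)).
have bound : forall i : 'I_k, (n - q i + \sum_(j < k | (j < i)%N) (n - s j)
     <= `|n%:Z - m|)%N.
  by move=> i; rewrite -lez_nat gez0_abs.
by move=> /(_ bound); lia.
Qed.
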